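(* Let $\mathbb{K}$ be a field of characteristic different from $3$. Let $A_1=A_z/\langle z-1\rangle$, where $A_z$ is the algebra defined in the context, and let $R$ be the $\mathbb{K}$-algebra generated by $f_2,f_3,f_4,f_5,f_6$ subject to the defining relations \begin{align*} f_3f_2&=f_2f_3, & f_4f_2&=f_2f_4, & f_4f_3&=f_3f_4, & f_5f_2&=f_2f_5, & f_5f_4&=f_4f_5, & f_6f_3&=f_3f_6,\\ f_6f_4&=f_4f_6, & f_6f_5&=f_5f_6, & f_4^2&=1/9, & f_6f_2&=f_2f_6+1, & f_5f_3&=f_3f_5-1. \end{align*} Then $R\cong A_1$ as $\mathbb{K}$-algebras.
   Context: Let $F=\mathbb{K}[z^{\pm1}]$. $A_z$ is the $F[(z^4+z^2+1)^{-1}]$-algebra generated by $e_1,\dots,e_6$ subject to the relations \begin{align*} &e_2e_1=z^{-3}e_1e_2,\quad e_3e_1=z^{-1}e_1e_3-(z+z^{-1}+z^{-3})e_2,\quad e_3e_2=z^{-3}e_2e_3,\\ &e_4e_1=e_1e_4+(1-z^2)e_3^2,\quad e_4e_2=z^{-3}e_2e_4-\tfrac{z^4-2z^2+1}{z^4+z^2+1}e_3^3,\quad e_4e_3=z^{-3}e_3e_4,\\ &e_5e_1=ze_1e_5-(1+z^2)e_3,\quad e_5e_2=e_2e_5+(1-z^2)e_3^2,\\ &e_5e_3=z^{-1}e_3e_5-(z+z^{-1}+z^{-3})e_4,\quad e_5e_4=z^{-3}e_4e_5,\\ &e_6e_1=z^3e_1e_6-z^3e_5,\quad e_6e_2=z^3e_2e_6+(z^4+z^2-1)e_4+(z^2-z^4)e_3e_5,\\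 &e_6e_3=e_3e_6+(1-z^2)e_5^2,\quad e_6e_4=z^{-3}e_4e_6-\tfrac{z^4-2z^2+1}{z^4+z^2+1}e_5^3,\quad e_6e_5=z^{-3}e_5e_6,\\ &(z^{-2}-1)e_1e_3e_5+(z^2+1+z^{-2})e_1e_4+(z^2+1+z^{-2})e_2e_5-z^4e_3^2=z^{-2}-1,\\ &(z^6-1)e_2e_4e_6-\tfrac{z^9(z^2-1)^2}{z^4+z^2+1}e_2e_5^3-\tfrac{z^9(z^2-1)^2}{z^4+z^2+1}e_3^3e_6+\tfrac{(z^6-1)(z^{13}-z^{11})}{(z^4+z^2+1)^2}e_3^2e_5^2\\ &\qquad-\tfrac{z^9(z^6-1)}{z^4+z^2+1}e_3e_4e_5+z^{12}e_4^2=\tfrac19. \end{align*} (For $q\in\mathbb{K}^*$ not a root of unity, specialising $z=q$ gives the algebra $U_q^+(G_2)/\langle\Omega_1-1,\Omega_2-\frac{1}{9(q^6-1)}\rangle$.) Setting $z=1$, $A_1$ is the $\mathbb{K}$-algebra generated by $e_1,\dots,e_6$ such that all pairs of generators commute except $e_3e_1=e_1e_3-3e_2$, $e_5e_1=e_1e_5-2e_3$, $e_5e_3=e_3e_5-3e_4$, $e_6e_1=e_1e_6-e_5$, $e_6e_2=e_2e_6+e_4$, together with $e_4^2=1/9$ and $e_3^2-3e_1e_4-3e_2e_5=0$. *)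

(* Defs.v *)
From HB Require Import structures.
From mathcomp Require Import all_boot all_order all_algebra.
From mathcomp Require Import boolp.
From mathcomp Require Import monalg.

Set Implicit Arguments.
Unset Strict Implicit.
Unset Printing Implicit Defensive.

Import GRing.Theory.
Import Quotient.

Local Open Scope ring_scope.
Local Open Scope quotient_scope.

(* Associative unital algebras over a commutative ring S, as rings A equipped
   with a ring morphism from S to the center of A; the scalar action is
   a *: x = alg_map a * x.  The library's [algType] is not usable here because it
   requires 1 != 0, which is not known a priori for an algebra given by
   generators and relations. *)
HB.mixin Record isPzAlgebra (S : comPzRingType) A of GRing.PzRing A := {
  alg_map : S -> A;
  alg_map_zmod_morphism : zmod_morphism alg_map;
  alg_map_monoid_morphism : monoid_morphism alg_map;
  alg_map_central : forall (a : S) (x : A), alg_map a * x = x * alg_map a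
}.

#[short(type="pzAlgType")]
HB.structure Definition PzAlgebra (S : comPzRingType) :=
  {A of GRing.PzRing A & isPzAlgebra S A}.

Arguments alg_map {S A} : rename.

HB.instance Definition _ (S : comPzRingType) (A : pzAlgType S) :=
  GRing.isZmodMorphism.Build S A alg_map alg_map_zmod_morphism.
HB.instance Definition _ (S : comPzRingType) (A : pzAlgType S) :=
  GRing.isMonoidMorphism.Build S A alg_map alg_map_monoid_morphism.

Definition pzalg_isomorphic (S : comPzRingType) (A B : pzAlgType S) : Prop :=
  exists2 f : {rmorphism A -> B},
    bijective f & forall a : S, f (alg_map a) = alg_map a.

Section TwoSidedIdeal.
Variables (A : pzRingType) (G : seq A).

Inductive ideal_gen : A -> Prop :=
| ideal_gen0 : ideal_gen 0
| ideal_genD x y : ideal_gen x -> ideal_gen y -> ideal_gen (x + y)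
| ideal_genM a g b : g \in G -> ideal_gen (a * g * b).

Definition ideal_gen_pred : A -> bool := fun x => `[< ideal_gen x >].

Lemma ideal_genN x : ideal_gen x -> ideal_gen (- x).
Proof.
elim=> [|u v _ Iu _ Iv|a g b Gg]; first by rewrite oppr0; exact: ideal_gen0.
  by rewrite opprD; exact: ideal_genD.
by rewrite -!mulNr; exact: ideal_genM.
Qed.

Lemma ideal_gen_mul a x b : ideal_gen x -> ideal_gen (a * x * b).
Proof.
elim=> [|u v _ Iu _ Iv|c g d Gg].
- by rewrite mulr0 mul0r; exact: ideal_gen0.
- by rewrite mulrDr mulrDl; exact: ideal_genD.
- by rewrite !mulrA -(mulrA _ d); exact: ideal_genM.
Qed.

Lemma ideal_gen_zmod_closed : zmod_closed ideal_gen_pred.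
Proof.
split=> [|x y /asboolP Ix /asboolP Iy]; apply/asboolP; first exact: ideal_gen0.
by apply: ideal_genD => //; exact: ideal_genN.
Qed.

HB.instance Definition _ :=
  GRing.isZmodClosed.Build A ideal_gen_pred ideal_gen_zmod_closed.

Definition ideal_generated : zmodClosed A :=
  GRing.ZmodClosed.clone A ideal_gen_pred _.

End TwoSidedIdeal.

(* The quotient of A by the two-sided ideal generated by G.  [ring_quotient]
   only has the ring structure for commutative rings. *)
Section Quotient.
Variables (A : pzRingType) (G : seq A).

Definition alg_quot : Type := {quot (ideal_generated G)}.

HB.instance Definition _ := GRing.Zmodule.on alg_quot.
HB.instance Definition _ := EqQuotient.on alg_quot.

Local Notation pi := (\pi_alg_quot).

Lemma alg_quotP (x y : A) : reflect (ideal_gen G (x - y)) (pi x == pi y).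
Proof.
by rewrite -(idealrBE (ideal_generated G)); exact: asboolP.
Qed.

Definition alg_quot_one : alg_quot := lift_cst alg_quot 1.
Definition alg_quot_mul := lift_op2 alg_quot *%R.

Lemma alg_quot_reprP (x : A) : ideal_gen G (x - repr (pi x)).
Proof. by apply/alg_quotP; rewrite reprK. Qed.

Lemma pi_alg_quot_one : pi 1 = alg_quot_one.
Proof. by rewrite /alg_quot_one; unlock. Qed.

Lemma pi_alg_quot_mul : {morph pi : x y / x * y >-> alg_quot_mul x y}.
Proof.
move=> x y; unlock alg_quot_mul; apply/eqP/alg_quotP.
rewrite -[x * y](subrK (x * repr (pi y))) -mulrBr -addrA -mulrBl.
apply: ideal_genD; first by rewrite -[_ * _]mulr1; apply: ideal_gen_mul;
  exact: alg_quot_reprP.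
by rewrite -[x - _]mul1r; apply: ideal_gen_mul; exact: alg_quot_reprP.
Qed.

Lemma pi_alg_quotD : {morph pi : x y / x + y >-> x + y}.
Proof. exact: (@Quotient.pi_add A (ideal_generated G)). Qed.

Lemma alg_quotW (P : alg_quot -> Prop) : (forall x, P (pi x)) -> forall x, P x.
Proof. by move=> PP x; rewrite -[x]reprK. Qed.

Let mulqA : associative alg_quot_mul.
Proof.
by do 3![elim/alg_quotW=> ?]; rewrite -!pi_alg_quot_mul mulrA.
Qed.
Let mul1q : left_id alg_quot_one alg_quot_mul.
Proof.
by elim/alg_quotW=> ?; rewrite -pi_alg_quot_one -!pi_alg_quot_mul mul1r.
Qed.
Let mulq1 : right_id alg_quot_one alg_quot_mul.
Proof.
by elim/alg_quotW=> ?; rewrite -pi_alg_quot_one -!pi_alg_quot_mul mulr1.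
Qed.
Let mulqDl : left_distributive alg_quot_mul +%R.
Proof.
do 3![elim/alg_quotW=> ?].
by rewrite -pi_alg_quotD -!pi_alg_quot_mul -pi_alg_quotD mulrDl.
Qed.
Let mulqDr : right_distributive alg_quot_mul +%R.
Proof.
do 3![elim/alg_quotW=> ?].
by rewrite -pi_alg_quotD -!pi_alg_quot_mul -pi_alg_quotD mulrDr.
Qed.

HB.instance Definition _ :=
  GRing.Zmodule_isPzRing.Build alg_quot mulqA mul1q mulq1 mulqDl mulqDr.

Lemma pi_alg_quot_zmod_morphism : zmod_morphism (pi : A -> alg_quot).
Proof.
move=> x y; rewrite pi_alg_quotD; congr (_ + _).
exact: (@Quotient.pi_opp A (ideal_generated G)).
Qed.

Lemma pi_alg_quot_monoid_morphism : monoid_morphism (pi : A -> alg_quot).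
Proof. by split; [exact: pi_alg_quot_one | exact: pi_alg_quot_mul]. Qed.

Definition alg_quot_pi : A -> alg_quot := pi.

HB.instance Definition _ := GRing.isZmodMorphism.Build A alg_quot
  alg_quot_pi pi_alg_quot_zmod_morphism.
HB.instance Definition _ := GRing.isMonoidMorphism.Build A alg_quot
  alg_quot_pi pi_alg_quot_monoid_morphism.

End Quotient.

Section AlgebraQuotient.
Variables (S : comPzRingType) (A : pzAlgType S) (G : seq A).

Definition alg_quot_map (a : S) : alg_quot G := alg_quot_pi G (alg_map a).

Let alg_quot_map_zmod_morphism : zmod_morphism alg_quot_map.
Proof. by move=> a b; rewrite /alg_quot_map !rmorphB. Qed.
Let alg_quot_map_monoid_morphism : monoid_morphism alg_quot_map.
Proof. by split=> [|a b]; rewrite /alg_quot_map ?rmorph1 // !rmorphM. Qed.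
Let alg_quot_map_central a x : alg_quot_map a * x = x * alg_quot_map a.
Proof.
elim/alg_quotW: x => x; rewrite -[\pi x]/(alg_quot_pi G x).
by rewrite /alg_quot_map -!rmorphM alg_map_central.
Qed.

HB.instance Definition _ := isPzAlgebra.Build S (alg_quot G)
  alg_quot_map_zmod_morphism alg_quot_map_monoid_morphism alg_quot_map_central.

End AlgebraQuotient.

Definition restrict_scalars (S T : comPzRingType) (iota : {rmorphism S -> T})
  (A : pzAlgType T) : Type := A.

Section RestrictScalars.
Variables (S T : comPzRingType) (iota : {rmorphism S -> T}) (A : pzAlgType T).

Local Notation A_S := (restrict_scalars iota A).

HB.instance Definition _ := GRing.PzRing.on A_S.

Definition restrict_map (a : S) : A_S := alg_map (iota a) : A.

Let restrict_map_zmod_morphism : zmod_morphism restrict_map.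
Proof. by move=> a b; rewrite /restrict_map !rmorphB. Qed.
Let restrict_map_monoid_morphism : monoid_morphism restrict_map.
Proof. by split=> [|a b]; rewrite /restrict_map ?rmorph1 // !rmorphM. Qed.
Let restrict_map_central a x : restrict_map a * x = x * restrict_map a.
Proof. exact: alg_map_central. Qed.

HB.instance Definition _ := isPzAlgebra.Build S A_S
  restrict_map_zmod_morphism restrict_map_monoid_morphism restrict_map_central.

End RestrictScalars.

(* The free associative S-algebra on n generators is the monoid algebra of the
   free monoid on 'I_n. *)
Section FreeAlgebra.
Variables (S : comNzRingType) (M : monomType).

Let malgC_zmod_morphism : zmod_morphism (@malgC M S).
Proof. exact: rmorphB. Qed.
Let malgC_monoid_morphism : monoid_morphism (@malgC M S).
Proof. by split; [exact: rmorph1 | exact: rmorphM]. Qed.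
Let malgC_central (a : S) (u : {malg S[M]}) : a%:MP * u = u * a%:MP.
Proof.
rewrite [u]monalgE mulr_suml mulr_sumr; apply: eq_bigr => k _.
by rewrite !malgM_def !fgmulUU mul1m mulm1 mulrC.
Qed.

HB.instance Definition _ := isPzAlgebra.Build S {malg S[M]}
  malgC_zmod_morphism malgC_monoid_morphism malgC_central.

Lemma alg_map_malg (a : S) (u : {malg S[M]}) : alg_map a * u = a *: u.
Proof. exact: mul_malgC. Qed.

End FreeAlgebra.

Notation free_alg S n := {malg S[{fmonom 'I_n}]}.

Definition free_gen (S : comNzRingType) (n : nat) (i : 'I_n) : free_alg S n :=
  << fmu i >>.

Local Notation "x %:F" := (FracField.tofrac x).

(* base K is the localization K[z^{+-1}][(z^4+z^2+1)^-1], as the subring of K(z)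
   of fractions with denominator z^n (z^4+z^2+1)^m. *)
Section Base.
Variable K : fieldType.

Definition cyc : {poly K} := 'X^4 + 'X^2 + 1.

Definition base_pred : {fraction {poly K}} -> bool :=
  fun x => `[< exists (p : {poly K}) (n m : nat),
                 x = p%:F / ('X ^+ n * cyc ^+ m)%:F >].

Lemma cyc_neq0 : cyc != 0.
Proof.
apply/eqP => /(congr1 (horner^~ 0))/eqP; rewrite /cyc !hornerE.
by rewrite !expr0n /= !add0r oner_eq0.
Qed.

Lemma base_den_neq0 n m : (('X : {poly K}) ^+ n * cyc ^+ m)%:F != 0.
Proof. by rewrite tofrac_eq0 mulf_neq0 ?expf_neq0 ?polyX_eq0 ?cyc_neq0. Qed.

Lemma base_subring_closed : subring_closed base_pred.
Proof.
split=> [|x y /asboolP[p [n [m ->]]] /asboolP[q [n' [m' ->]]]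
         |x y /asboolP[p [n [m ->]]] /asboolP[q [n' [m' ->]]]]; apply/asboolP.
- by exists 1, 0, 0; rewrite !expr0 mulr1 rmorph1 divr1.
- exists (p * ('X ^+ n' * cyc ^+ m') - q * ('X ^+ n * cyc ^+ m)).
  exists (n + n')%N, (m + m')%N.
  have -> : 'X ^+ (n + n') * cyc ^+ (m + m')
          = ('X ^+ n * cyc ^+ m) * ('X ^+ n' * cyc ^+ m').
    by rewrite !exprD mulrACA.
  rewrite -mulNr addf_div ?base_den_neq0 // mulNr.
  by rewrite (tofracB (p * _)) !(tofracM p, tofracM q) (tofracM ('X ^+ n * _)).
- exists (p * q), (n + n')%N, (m + m')%N.
  rewrite mulf_div -!rmorphM; congr (_ / _%:F).
  by rewrite !exprD mulrACA.
Qed.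

HB.instance Definition _ := GRing.isSubringClosed.Build {fraction {poly K}}
  base_pred base_subring_closed.

Record base := Base { base_val : {fraction {poly K}}; _ : base_pred base_val }.

HB.instance Definition _ := [isSub for base_val].
HB.instance Definition _ := [Choice of base by <:].
HB.instance Definition _ := [SubChoice_isSubComNzRing of base by <:].

Definition base_unit : {pred base} := fun x => `[< exists y, y * x = 1 >].
Definition base_inv (x : base) : base :=
  if pselect (exists y, y * x = 1) is left e then projT1 (cid e) else x.

Let base_mulVx : {in base_unit, left_inverse 1 base_inv *%R}.
Proof.
move=> x /asboolP ex; rewrite /base_inv; case: pselect => // e.
by case: cid.
Qed.
Let base_unitPl x y : y * x = 1 -> base_unit x.
Proof. by move=> yx; apply/asboolP; exists y. Qed.
Let base_invr_out : {in [predC base_unit], base_inv =1 id}.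
Proof. by move=> x /asboolP nex; rewrite /base_inv; case: pselect. Qed.

HB.instance Definition _ := GRing.ComNzRing_hasMulInverse.Build base
  base_mulVx base_unitPl base_invr_out.

Lemma base_of_poly_subproof (p : {poly K}) : base_pred p%:F.
Proof.
by apply/asboolP; exists p, 0, 0; rewrite !expr0 mulr1 rmorph1 divr1.
Qed.

Definition base_of_poly (p : {poly K}) : base := Base (base_of_poly_subproof p).

Lemma base_of_poly_zmod_morphism : zmod_morphism base_of_poly.
Proof. by move=> p q; apply: val_inj; rewrite /= rmorphB. Qed.
Lemma base_of_poly_monoid_morphism : monoid_morphism base_of_poly.
Proof. by split=> [|p q]; apply: val_inj; rewrite /= ?rmorph1 ?rmorphM. Qed.

HB.instance Definition _ := GRing.isZmodMorphism.Build {poly K} base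
  base_of_poly base_of_poly_zmod_morphism.
HB.instance Definition _ := GRing.isMonoidMorphism.Build {poly K} base
  base_of_poly base_of_poly_monoid_morphism.

Definition base_z : base := base_of_poly 'X.

Definition base_const : {rmorphism K -> base} := base_of_poly \o polyC.

Lemma base_z_unit : base_z \is a GRing.unit.
Proof.
have pV : base_pred (('X : {poly K})%:F)^-1.
  by apply/asboolP; exists 1, 1, 0; rewrite expr0 mulr1 expr1 rmorph1 div1r.
apply/asboolP; exists (Base pV); apply: val_inj => /=.
by rewrite mulVf // tofrac_eq0 polyX_eq0.
Qed.

Lemma base_cyc_unit : base_z ^+ 4 + base_z ^+ 2 + 1 \is a GRing.unit.
Proof.
have -> : base_z ^+ 4 + base_z ^+ 2 + 1 = base_of_poly cyc.
  by rewrite /cyc !rmorphE.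
have pV : base_pred (cyc%:F)^-1.
  by apply/asboolP; exists 1, 0, 1; rewrite expr0 mul1r expr1 rmorph1 div1r.
apply/asboolP; exists (Base pV); apply: val_inj => /=.
by rewrite mulVf // tofrac_eq0 cyc_neq0.
Qed.

End Base.

(* A relation l = r is recorded as the element l - r of the free algebra. *)
Local Notation "l =~ r" := (l - r) (at level 70, no associativity, only parsing).

Section Algebras.
Variable K : fieldType.

Section Az.
Local Notation e i := (free_gen (base K) (@Ordinal 6 i%N.-1 isT)).
Local Notation z := (base_z K).

Definition Az_relations : seq (free_alg (base K) 6) := [::
  e 2 * e 1 =~ z ^- 3 *: (e 1 * e 2);
  e 3 * e 1 =~ z^-1 *: (e 1 * e 3) - (z + z^-1 + z ^- 3) *: e 2;
  e 3 * e 2 =~ z ^- 3 *: (e 2 * e 3);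
  e 4 * e 1 =~ e 1 * e 4 + (1 - z ^+ 2) *: e 3 ^+ 2;
  e 4 * e 2 =~ z ^- 3 *: (e 2 * e 4)
    - ((z ^+ 4 - 2%:R * z ^+ 2 + 1) / (z ^+ 4 + z ^+ 2 + 1)) *: e 3 ^+ 3;
  e 4 * e 3 =~ z ^- 3 *: (e 3 * e 4);
  e 5 * e 1 =~ z *: (e 1 * e 5) - (1 + z ^+ 2) *: e 3;
  e 5 * e 2 =~ e 2 * e 5 + (1 - z ^+ 2) *: e 3 ^+ 2;
  e 5 * e 3 =~ z^-1 *: (e 3 * e 5) - (z + z^-1 + z ^- 3) *: e 4;
  e 5 * e 4 =~ z ^- 3 *: (e 4 * e 5);
  e 6 * e 1 =~ z ^+ 3 *: (e 1 * e 6) - z ^+ 3 *: e 5;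
  e 6 * e 2 =~ z ^+ 3 *: (e 2 * e 6) + (z ^+ 4 + z ^+ 2 - 1) *: e 4
    + (z ^+ 2 - z ^+ 4) *: (e 3 * e 5);
  e 6 * e 3 =~ e 3 * e 6 + (1 - z ^+ 2) *: e 5 ^+ 2;
  e 6 * e 4 =~ z ^- 3 *: (e 4 * e 6)
    - ((z ^+ 4 - 2%:R * z ^+ 2 + 1) / (z ^+ 4 + z ^+ 2 + 1)) *: e 5 ^+ 3;
  e 6 * e 5 =~ z ^- 3 *: (e 5 * e 6);
  (z ^- 2 - 1) *: (e 1 * e 3 * e 5)
    + (z ^+ 2 + 1 + z ^- 2) *: (e 1 * e 4)
    + (z ^+ 2 + 1 + z ^- 2) *: (e 2 * e 5)
    - z ^+ 4 *: e 3 ^+ 2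
  =~ (z ^- 2 - 1) *: 1;
  (z ^+ 6 - 1) *: (e 2 * e 4 * e 6)
    - (z ^+ 9 * (z ^+ 2 - 1) ^+ 2 / (z ^+ 4 + z ^+ 2 + 1)) *: (e 2 * e 5 ^+ 3)
    - (z ^+ 9 * (z ^+ 2 - 1) ^+ 2 / (z ^+ 4 + z ^+ 2 + 1)) *: (e 3 ^+ 3 * e 6)
    + ((z ^+ 6 - 1) * (z ^+ 13 - z ^+ 11) / (z ^+ 4 + z ^+ 2 + 1) ^+ 2)
        *: (e 3 ^+ 2 * e 5 ^+ 2)
    - (z ^+ 9 * (z ^+ 6 - 1) / (z ^+ 4 + z ^+ 2 + 1)) *: (e 3 * e 4 * e 5)
    + z ^+ 12 *: e 4 ^+ 2
  =~ 9%:R^-1 *: 1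
].

Definition Az : pzAlgType (base K) := alg_quot Az_relations.

Definition A1 : pzAlgType K :=
  restrict_scalars (base_const K) (alg_quot [:: alg_map (z - 1) : Az]).
End Az.

Section Ralg.
Local Notation f i := (free_gen K (@Ordinal 5 i%N.-2 isT)).

Definition Ralg_relations : seq (free_alg K 5) := [::
  f 3 * f 2 =~ f 2 * f 3;
  f 4 * f 2 =~ f 2 * f 4;
  f 4 * f 3 =~ f 3 * f 4;
  f 5 * f 2 =~ f 2 * f 5;
  f 5 * f 4 =~ f 4 * f 5;
  f 6 * f 3 =~ f 3 * f 6;
  f 6 * f 4 =~ f 4 * f 6;
  f 6 * f 5 =~ f 5 * f 6;
  f 4 ^+ 2 =~ 9%:R^-1 *: 1;
  f 6 * f 2 =~ f 2 * f 6 + 1;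
  f 5 * f 3 =~ f 3 * f 5 - 1
].

Definition Ralg : pzAlgType K := alg_quot Ralg_relations.
End Ralg.

End Algebras.

(* Main.v *)
(* At z = 1 the element e4 becomes central with 9 e4^2 = 1, hence invertible.
   The quadratic relation then reads 3 e1 e4 = e3^2 - 3 e2 e5, so e1 is
   redundant, and rescaling e5 and e6 by e4 gives two commuting Weyl pairs:
     f2, f3, f4, f5, f6 |-> e2, e3, e4, 3 e4 e5, 9 e4 e6,
   with inverse e1 |-> 3 (f4 f3^2 - f2 f5), e5 |-> 3 f4 f5, e6 |-> f4 f6. *)
From HB Require Import structures.
From mathcomp Require Import all_boot all_order all_algebra.
From mathcomp Require Import boolp finmap monalg.
Require Import Defs.

Set Implicit Arguments.
Unset Strict Implicit.
Unset Printing Implicit Defensive.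

Import GRing.Theory.

Local Open Scope ring_scope.
Local Open Scope quotient_scope.

Local Notation e i := (@Ordinal 6 i%N.-1 isT).
Local Notation f i := (@Ordinal 5 i%N.-2 isT).

(** * Universal properties of quotients and of free algebras *)

Lemma alg_quot_pi0 (A : pzRingType) (G : seq A) (g : A) :
  g \in G -> alg_quot_pi G g = 0.
Proof.
move=> Gg; rewrite -(rmorph0 (alg_quot_pi G)); apply/eqP/alg_quotP.
by rewrite subr0 -[g]mul1r -[_ * _]mulr1; exact: ideal_genM.
Qed.

(** Existence half of the universal property. By induction on ideal membership [f] kills the whole
    ideal, so its value on the chosen representative of a class is independent of the choice. *)
Lemma alg_quot_rmorph (A B : pzRingType) (G : seq A) (f : {rmorphism A -> B}) :
    (forall g, g \in G -> f g = 0) ->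
  exists h : {rmorphism alg_quot G -> B}, forall x, h (alg_quot_pi G x) = f x.
Proof.
move=> fG; pose h (x : alg_quot G) := f (repr x).
have f0 x : ideal_gen G x -> f x = 0.
  elim=> [|u v _ fu _ fv|a g b Gg]; first exact: rmorph0.
    by rewrite rmorphD fu fv addr0.
  by rewrite !rmorphM (fG g) // mulr0 mul0r.
have hE x : h (alg_quot_pi G x) = f x.
  apply/esym/eqP; rewrite -subr_eq0 -rmorphB; apply/eqP/f0.
  exact: alg_quot_reprP.
have hB : zmod_morphism h.
  elim/alg_quotW=> x; elim/alg_quotW=> y.
  rewrite -[\pi x]/(alg_quot_pi G x) -[\pi y]/(alg_quot_pi G y).
  by rewrite -rmorphB !hE rmorphB.
have hM : monoid_morphism h.
  split; first by rewrite -(rmorph1 (alg_quot_pi G)) hE rmorph1.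
  elim/alg_quotW=> x; elim/alg_quotW=> y.
  rewrite -[\pi x]/(alg_quot_pi G x) -[\pi y]/(alg_quot_pi G y).
  by rewrite -rmorphM !hE rmorphM.
pose hP : {rmorphism alg_quot G -> B} :=
  HB.pack h (GRing.isZmodMorphism.Build _ _ h hB)
            (GRing.isMonoidMorphism.Build _ _ h hM).
by exists hP.
Qed.

Lemma alg_quot_ext (A : pzRingType) (G : seq A) (T : Type) (f g : alg_quot G -> T) :
  (forall x, f (alg_quot_pi G x) = g (alg_quot_pi G x)) -> f =1 g.
Proof. by move=> fg; elim/alg_quotW=> x; exact: fg. Qed.

(** Words go to the products of the images of their letters, and sums are extended linearly.
    Multiplicativity needs the image of [phi] to be central, so that coefficients can be moved past
    words. *)
Lemma free_alg_rmorph (S : comNzRingType) (n : nat) (B : pzRingType)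
    (phi : {rmorphism S -> B}) (g : 'I_n -> B) :
    (forall a x, phi a * x = x * phi a) ->
  exists2 f : {rmorphism free_alg S n -> B},
    forall a, f (alg_map a) = phi a & forall i, f (free_gen S i) = g i.
Proof.
move=> phiC; pose h (k : {fmonom 'I_n}) : B := \prod_(i <- (k : seq 'I_n)) g i.
have h1 : h mone = 1 by rewrite /h fm1 big_nil.
have hM k l : h (mmul k l) = h k * h l by rewrite /h fmM big_cat.
pose f (u : free_alg S n) : B := \sum_(k <- msupp u) phi u@_k * h k.
(* The sum may run over any finite set containing the support, so two elements can be compared over
   the union of their supports. *)
have fEw (d : {fset {fmonom 'I_n}}) u : (msupp u `<=` d)%fset ->
    f u = \sum_(k <- d) phi u@_k * h k.
  move=> le; rewrite /f (big_fset_incl _ le) // => k _ /mcoeff_outdom ->.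
  by rewrite rmorph0 mul0r.
have fB : zmod_morphism f.
  move=> u v; pose d := (msupp u `|` msupp v)%fset.
  rewrite !(fEw d) ?fsubsetUl ?fsubsetUr ?msuppB_le // -sumrB.
  by apply: eq_bigr => k _; rewrite mcoeffB rmorphB mulrBl.
pose fA : {additive free_alg S n -> B} :=
  HB.pack f (GRing.isZmodMorphism.Build _ _ f fB).
have fU c k : f << c *g k >> = phi c * h k.
  by rewrite (fEw [fset k]%fset) ?msuppU_le // big_seq_fset1 mcoeffUU.
have fM : monoid_morphism f.
  split; first by rewrite fU rmorph1 h1 mul1r.
  move=> u v; rewrite [u]monalgE [v]monalgE mulr_suml.
  rewrite -[f]/(fA : _ -> _) !raddf_sum mulr_suml; apply: eq_bigr => k _.
  rewrite !mulr_sumr raddf_sum; apply: eq_bigr => l _.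
  rewrite malgM_def fgmulUU /= !fU hM rmorphM -!mulrA; congr (_ * _).
  by rewrite !mulrA; congr (_ * _); rewrite phiC.
pose fP : {rmorphism free_alg S n -> B} :=
  HB.pack f (GRing.isZmodMorphism.Build _ _ f fB)
            (GRing.isMonoidMorphism.Build _ _ f fM).
exists fP => [a|i]; first by rewrite [LHS]fU h1 mulr1.
by rewrite [LHS]fU rmorph1 mul1r /h fmU big_seq1.
Qed.

(** Every element is a sum of scalars times words, and a word is a product of generators, by
    induction on its length. *)
Lemma free_alg_ext (S : comNzRingType) (n : nat) (B : pzRingType)
    (f g : {rmorphism free_alg S n -> B}) :
    (forall a, f (alg_map a) = g (alg_map a)) ->
    (forall i, f (free_gen S i) = g (free_gen S i)) -> f =1 g.
Proof.
move=> fgS fgi u; rewrite [u]monalgE !rmorph_sum; apply: eq_bigr => k _.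
have -> : << u@_k *g k >> = (u@_k)%:MP * << k >> :> free_alg S n.
  by rewrite malgM_def fgmulUU mulr1 mul1m.
rewrite !rmorphM -[_%:MP]/(alg_map u@_k) fgS; congr (_ * _); case: k => s.
elim: s => [|i s IHs].
  have -> : FMonom [::] = mone :> {fmonom 'I_n} by rewrite /mone /= fmoneE.
  by rewrite mpolyC1E !rmorph1.
have -> : << FMonom (i :: s) >> = free_gen S i * << FMonom s >>.
  by rewrite malgM_def fgmulUU mulr1 /mmul /= fmmulE fmuE.
by rewrite !rmorphM fgi IHs.
Qed.

(** * The localized Laurent ring and its evaluation at z = 1 *)

Lemma base_fracP (K : fieldType) (b : base K) : exists (p d : {poly K}),
  [/\ b * base_of_poly d = base_of_poly p, base_of_poly d \is a GRing.unit &
      exists n m : nat, d = 'X ^+ n * cyc K ^+ m].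
Proof.
case: b => x bx; have /asboolP[p [n [m xE]]] := bx.
exists p, ('X ^+ n * cyc K ^+ m); split; last by exists n, m.
  by apply: val_inj; rewrite /= xE divfK // base_den_neq0.
rewrite rmorphM !rmorphXn unitrM unitrX ?base_z_unit //= unitrX //.
have -> : base_of_poly (cyc K) = base_z K ^+ 4 + base_z K ^+ 2 + 1.
  by rewrite /cyc !rmorphE.
exact: base_cyc_unit.
Qed.

(** Constants and z determine a morphism on polynomials. The denominators are units, which
    determines it on fractions. *)
Lemma base_rmorph_ext (K : fieldType) (B : pzRingType)
    (f g : {rmorphism base K -> B}) :
    (forall c, f (base_const K c) = g (base_const K c)) ->
    f (base_z K) = g (base_z K) -> f =1 g.
Proof.
move=> fgC fgz b.
have fgp p : f (base_of_poly p) = g (base_of_poly p).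
  rewrite -[p]coefK poly_def !rmorph_sum; apply: eq_bigr => i _ /=.
  rewrite -mul_polyC !(rmorphM, rmorphXn) -/(base_z K) /= fgz.
  by congr (_ * _); exact: fgC.
have [p [d [bd dU _]]] := base_fracP b.
rewrite -[b](mulrK dU) bd !rmorphM fgp; congr (_ * _).
(* Uniqueness of inverses in the possibly noncommutative [B]: f(1/d) = g(1/d) g(d) f(1/d) = g(1/d)
   f(d) f(1/d) = g(1/d). *)
rewrite -[LHS]mul1r -(rmorph1 g) -(mulVr dU) rmorphM -fgp -mulrA -(rmorphM f).
by rewrite divrr // rmorph1 mulr1.
Qed.

(** A fraction p/d goes to p(1)/d(1). The denominators are z^n (z^4+z^2+1)^m, with value 3^m at 1;
    this is where the characteristic must differ from 3. *)
Lemma base_eval1 (K : fieldType) : (3%:R : K) != 0 ->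
  exists2 ev : {rmorphism base K -> K},
    forall c, ev (base_const K c) = c & ev (base_z K) = 1.
Proof.
move=> nz3.
have den_neq0 n m : ('X ^+ n * cyc K ^+ m).[1] != 0.
  rewrite hornerM !horner_exp hornerX expr1n mul1r expf_neq0 //.
  by rewrite /cyc !hornerE !expr1n -(natrD _ 1 1) -(natrD _ 2 1).
(* The value is characterized against all fractions representing [b] at once. Independence of the
   fraction is cross multiplication, which descends from the fraction field to polynomials. *)
have ex b : exists a : K, forall p d : {poly K},
    b * base_of_poly d = base_of_poly p -> a * d.[1] = p.[1].
  have [q [e [be eU [n [m eE]]]]] := base_fracP b.
  exists (q.[1] / e.[1]) => p d bd; have e0 : e.[1] != 0 by rewrite eE.
  apply: (mulIf e0); rewrite mulrAC divfK // -!hornerM; congr _.[1].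
  have /(congr1 (@base_val K))/eqP : base_of_poly (q * d) = base_of_poly (p * e).
    by rewrite (rmorphM _ q) (rmorphM _ p) /= -be -bd mulrAC.
  by rewrite /= tofrac_eq => /eqP ->.
pose ev b := sval (cid (ex b)).
have evP b p d : b * base_of_poly d = base_of_poly p -> ev b * d.[1] = p.[1].
  exact: (svalP (cid (ex b))).
have evp p : ev (base_of_poly p) = p.[1].
  by have := evP (base_of_poly p) p 1; rewrite rmorph1 !mulr1 hornerC mulr1 => ->.
have evM : monoid_morphism ev.
  split; first by rewrite -(rmorph1 (@base_of_poly K)) evp hornerC.
  move=> a b; have [p [d [ad _ [n [m dE]]]]] := base_fracP a.
  have [q [e [be _ [n' [m' eE]]]]] := base_fracP b.
  have d0 : d.[1] != 0 by rewrite dE.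
  have e0 : e.[1] != 0 by rewrite eE.
  apply: (mulIf (mulf_neq0 d0 e0)); rewrite mulrACA (evP _ _ _ ad) (evP _ _ _ be).
  by rewrite -!hornerM; apply: evP; rewrite !rmorphM mulrACA ad be.
have evB : zmod_morphism ev.
  move=> a b; have [p [d [ad _ [n [m dE]]]]] := base_fracP a.
  have [q [e [be _ [n' [m' eE]]]]] := base_fracP b.
  have d0 : d.[1] != 0 by rewrite dE.
  have e0 : e.[1] != 0 by rewrite eE.
  apply: (mulIf (mulf_neq0 d0 e0)).
  rewrite [RHS]mulrBl (mulrA (ev a)) (evP _ _ _ ad) (mulrCA (ev b)) (evP _ _ _ be).
  rewrite -!hornerM -hornerN -hornerD; apply: evP.
  by rewrite rmorphB !rmorphM mulrBl mulrA ad mulrCA be.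
pose evR : {rmorphism base K -> K} :=
  HB.pack ev (GRing.isZmodMorphism.Build _ _ ev evB)
             (GRing.isMonoidMorphism.Build _ _ ev evM).
exists evR => [c|]; first by rewrite [LHS]evp hornerC.
by rewrite [LHS]evp hornerX.
Qed.

(** * Relators over arbitrary algebras and their specialization at z = 1 *)

(* [Az_relators] at z = 1. *)
Definition A1_relators (K : fieldType) (B : pzAlgType K) (x1 x2 x3 x4 x5 x6 : B) :
  seq B := [::
  x2 * x1 - x1 * x2;
  x3 * x1 - (x1 * x3 - x2 *+ 3);
  x3 * x2 - x2 * x3;
  x4 * x1 - x1 * x4;
  x4 * x2 - x2 * x4;
  x4 * x3 - x3 * x4;
  x5 * x1 - (x1 * x5 - x3 *+ 2);
  x5 * x2 - x2 * x5;
  x5 * x3 - (x3 * x5 - x4 *+ 3);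
  x5 * x4 - x4 * x5;
  x6 * x1 - (x1 * x6 - x5);
  x6 * x2 - (x2 * x6 + x4);
  x6 * x3 - x3 * x6;
  x6 * x4 - x4 * x6;
  x6 * x5 - x5 * x6;
  (x1 * x4) *+ 3 + (x2 * x5) *+ 3 - x3 ^+ 2;
  x4 ^+ 2 - alg_map 9%:R^-1].

(** Taking arbitrary elements as arguments lets one list serve in the free algebra, in its quotient
    and in any target of a morphism. *)
Definition R_relators (K : fieldType) (B : pzAlgType K) (y2 y3 y4 y5 y6 : B) :
  seq B := [::
  y3 * y2 - y2 * y3;
  y4 * y2 - y2 * y4;
  y4 * y3 - y3 * y4;
  y5 * y2 - y2 * y5;
  y5 * y4 - y4 * y5;
  y6 * y3 - y3 * y6;
  y6 * y4 - y4 * y6;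
  y6 * y5 - y5 * y6;
  y4 ^+ 2 - alg_map 9%:R^-1;
  y6 * y2 - (y2 * y6 + 1);
  y5 * y3 - (y3 * y5 - 1)].

(* Stated over an arbitrary algebra: in the monoid algebra, failed rewrites make
   unification unfold the ring operations and do not terminate in practice. *)
Definition Az_relators (S : comUnitRingType) (L : lalgType S) (z : S)
  (e1 e2 e3 e4 e5 e6 : L) : seq L := [::
  e2 * e1 - z ^- 3 *: (e1 * e2);
  e3 * e1 - (z^-1 *: (e1 * e3) - (z + z^-1 + z ^- 3) *: e2);
  e3 * e2 - z ^- 3 *: (e2 * e3);
  e4 * e1 - (e1 * e4 + (1 - z ^+ 2) *: e3 ^+ 2);
  e4 * e2 - (z ^- 3 *: (e2 * e4)
    - ((z ^+ 4 - 2%:R * z ^+ 2 + 1) / (z ^+ 4 + z ^+ 2 + 1)) *: e3 ^+ 3);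
  e4 * e3 - z ^- 3 *: (e3 * e4);
  e5 * e1 - (z *: (e1 * e5) - (1 + z ^+ 2) *: e3);
  e5 * e2 - (e2 * e5 + (1 - z ^+ 2) *: e3 ^+ 2);
  e5 * e3 - (z^-1 *: (e3 * e5) - (z + z^-1 + z ^- 3) *: e4);
  e5 * e4 - z ^- 3 *: (e4 * e5);
  e6 * e1 - (z ^+ 3 *: (e1 * e6) - z ^+ 3 *: e5);
  e6 * e2 - (z ^+ 3 *: (e2 * e6) + (z ^+ 4 + z ^+ 2 - 1) *: e4
    + (z ^+ 2 - z ^+ 4) *: (e3 * e5));
  e6 * e3 - (e3 * e6 + (1 - z ^+ 2) *: e5 ^+ 2);
  e6 * e4 - (z ^- 3 *: (e4 * e6)
    - ((z ^+ 4 - 2%:R * z ^+ 2 + 1) / (z ^+ 4 + z ^+ 2 + 1)) *: e5 ^+ 3);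
  e6 * e5 - z ^- 3 *: (e5 * e6);
  (z ^- 2 - 1) *: (e1 * e3 * e5)
    + (z ^+ 2 + 1 + z ^- 2) *: (e1 * e4)
    + (z ^+ 2 + 1 + z ^- 2) *: (e2 * e5)
    - z ^+ 4 *: e3 ^+ 2
  - ((z ^- 2 - 1) *: 1);
  (z ^+ 6 - 1) *: (e2 * e4 * e6)
    - (z ^+ 9 * (z ^+ 2 - 1) ^+ 2 / (z ^+ 4 + z ^+ 2 + 1)) *: (e2 * e5 ^+ 3)
    - (z ^+ 9 * (z ^+ 2 - 1) ^+ 2 / (z ^+ 4 + z ^+ 2 + 1)) *: (e3 ^+ 3 * e6)
    + ((z ^+ 6 - 1) * (z ^+ 13 - z ^+ 11) / (z ^+ 4 + z ^+ 2 + 1) ^+ 2)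
        *: (e3 ^+ 2 * e5 ^+ 2)
    - (z ^+ 9 * (z ^+ 6 - 1) / (z ^+ 4 + z ^+ 2 + 1)) *: (e3 * e4 * e5)
    + z ^+ 12 *: e4 ^+ 2
  - 9%:R^-1 *: 1].

Lemma Az_relationsE (K : fieldType) (x := @free_gen (base K) 6) :
  Az_relations K =
    Az_relators (base_z K) (x (e 1)) (x (e 2)) (x (e 3)) (x (e 4)) (x (e 5)) (x (e 6)).
Proof. by []. Qed.

Lemma Ralg_relationsE (K : fieldType) (x := @free_gen K 5) :
  Ralg_relations K = R_relators (x (f 2)) (x (f 3)) (x (f 4)) (x (f 5)) (x (f 6)).
Proof.
(* Only the ninth entry differs in form: its constant is a multiple of 1 on one side and an image of
   [alg_map] on the other. *)
do 8![apply: (congr2 cons); first by []].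
apply: (congr2 cons); last by [].
by congr (_ - _); rewrite -alg_map_malg mulr1.
Qed.

Lemma map_R_relators (K : fieldType) (A B : pzAlgType K)
    (h : {rmorphism A -> B}) (y2 y3 y4 y5 y6 : A) :
    (forall c, h (alg_map c) = alg_map c) ->
  map h (R_relators y2 y3 y4 y5 y6) = R_relators (h y2) (h y3) (h y4) (h y5) (h y6).
Proof.
move=> hC; rewrite /R_relators /=.
by rewrite !(rmorphB, rmorphD, rmorphM, rmorph1, rmorphXn, hC).
Qed.

(** All powers of z become 1. Thus z + z^-1 + z^-3 becomes 3, 1 + z^2 becomes 2, and every
    coefficient with denominator z^4+z^2+1 has a numerator vanishing at 1. *)
Lemma map_Az_relators (S : comUnitRingType) (L : lalgType S) (z : S)
    (K : fieldType) (B : pzAlgType K) (ev : {rmorphism S -> K})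
    (h : {rmorphism L -> B}) (e1 e2 e3 e4 e5 e6 : L) :
    z \is a GRing.unit -> (9%:R : S) \is a GRing.unit -> ev z = 1 ->
    (forall b, h b%:A = alg_map (ev b)) ->
  map h (Az_relators z e1 e2 e3 e4 e5 e6) =
    A1_relators (h e1) (h e2) (h e3) (h e4) (h e5) (h e6).
Proof.
move=> zU U9 evz hC; have hZ c u : h (c *: u) = alg_map (ev c) * h u.
  by rewrite -hC -rmorphM mulr_algl.
have evX n : ev (z ^+ n) = 1 by rewrite rmorphXn /= evz expr1n.
have evV n : ev (z ^- n) = 1 by rewrite rmorphV ?unitrX //= evX invr1.
have ev9 : ev 9%:R^-1 = 9%:R^-1 by rewrite rmorphV ?rmorph_nat.
have evV1 : ev z^-1 = 1 by rewrite -[z^-1]/(z ^- 1).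
have hE := (rmorphB h, rmorphD h, rmorphM h, rmorphXn h, rmorph1 h, hZ).
have evE := (rmorphB ev, rmorphD ev, rmorphM ev, evX, evV, evV1, evz, rmorph1 ev,
  rmorph_nat ev).
(* The evaluated coefficients appear as sums of ones; these facts turn them into multiples. *)
have h3 u : alg_map (1 + 1 + 1 : K) * u = u *+ 3.
  by rewrite -(natrD _ 1 1) -(natrD _ 2 1) rmorph_nat mulr_natl.
have h2 u : alg_map (1 + 1 : K) * u = u *+ 2.
  by rewrite -(natrD _ 1 1) rmorph_nat mulr_natl.
have k1 : (1 : K) + 1 - 1 = 1 by rewrite addrK.
have k0 : (1 : K) - 2%:R + 1 = 0 by rewrite addrAC subrr.
do 17?[apply: (congr2 cons)]; last by [].
all: rewrite !hE ?ev9 ?evE.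
all: by rewrite ?(mulr1, k0, k1, subrr (1 : K), mul0r, mulr0, rmorph0, rmorph1,
  mul1r, h3, h2, oppr0, add0r, addr0).
Qed.

(** * The change of generators between the two presentations *)

(** Since 9 x^2 = 1, the element 9 x is inverse to x. The factor [y] allows cancellation at the head
    of a longer product. *)
Lemma alg_map9V (K : fieldType) (B : pzAlgType K) (x y : B) :
  (3%:R : K) != 0 -> x ^+ 2 = alg_map 9%:R^-1 -> (x * (x * y)) *+ 9 = y.
Proof.
move=> nz3 xx; have nz9 : (9%:R : K) != 0 by rewrite (natrM _ 3 3) mulf_neq0.
rewrite mulrA -expr2 xx -mulr_natl mulrA -(rmorph_nat (@alg_map K B)) -rmorphM.
by rewrite mulfV // rmorph1 mul1r.
Qed.

(** Makes the map from [A1] to [Ralg] well defined. The two final equations say that undoing the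
    rescaling returns [y5] and [y6], as one composite requires. *)
Lemma R_to_A1_relators (K : fieldType) (B : pzAlgType K) (y2 y3 y4 y5 y6 : B) :
    (3%:R : K) != 0 -> all (pred1 0) (R_relators y2 y3 y4 y5 y6) ->
  all (pred1 0) (A1_relators ((y4 * y3 ^+ 2 - y2 * y5) *+ 3) y2 y3 y4
                             ((y4 * y5) *+ 3) (y4 * y6)) /\
  (y4 * (y4 * y5 *+ 3) *+ 3 = y5 /\ y4 * (y4 * y6) *+ 9 = y6).
Proof.
move=> nz3; rewrite /= !subr_eq0 !andbT.
case/and5P=> /eqP c32 /eqP c42 /eqP c43 /eqP c52.
case/and5P=> /eqP c54 /eqP c63 /eqP c64 /eqP c65.
case/and3P=> /eqP y44 /eqP c62 /eqP c53.
have y4K u : (y4 * (y4 * u)) *+ 9 = u by exact: alg_map9V.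
(* Rewriting to normal form with y4 < y2 < y3 < y5 < y6. *)
have r32 u : y3 * (y2 * u) = y2 * (y3 * u) by rewrite !mulrA c32.
have r24 u : y2 * (y4 * u) = y4 * (y2 * u) by rewrite !mulrA c42.
have r34 u : y3 * (y4 * u) = y4 * (y3 * u) by rewrite !mulrA c43.
have r52 u : y5 * (y2 * u) = y2 * (y5 * u) by rewrite !mulrA c52.
have r54 u : y5 * (y4 * u) = y4 * (y5 * u) by rewrite !mulrA c54.
have r63 u : y6 * (y3 * u) = y3 * (y6 * u) by rewrite !mulrA c63.
have r64 u : y6 * (y4 * u) = y4 * (y6 * u) by rewrite !mulrA c64.
have r65 u : y6 * (y5 * u) = y5 * (y6 * u) by rewrite !mulrA c65.
have r62 u : y6 * (y2 * u) = y2 * (y6 * u) + u.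
  by rewrite !mulrA c62 mulrDl mul1r.
have r53 u : y5 * (y3 * u) = y3 * (y5 * u) - u.
  by rewrite !mulrA c53 mulrBl mul1r.
have n3 (u : B) : u *+ 3 *+ 3 = u *+ 9 by rewrite -mulrnA.
split; last by rewrite mulrnAr n3 !y4K.
rewrite (expr2 y3).
do 16?[apply/andP; split].
all: rewrite ?(mulrnAl, mulrnAr) ?n3 ?(mulrBl, mulrBr) -?mulrA.
all: rewrite ?(r32, r24, r34, r52, r54, r63, r64, r65, r62, r53, c32, c52, c54, c63,
  c64, c65, c62, c53, =^~ c42, =^~ c43, mulrBr, mulrDr, mulr1) ?(mulrnBl, y4K, mulrnDl).
all: rewrite ?y44 //; apply/eqP.
(* The remaining goals involve the substituted e1: its commutation with e3, e5 and e6, then the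
   quadratic relation. Only additive rearrangement is left. *)
- by rewrite opprB addrA [RHS]addrAC addrK.
- move: (_ *+ 9) (y3 * _) => b a.
  by rewrite mulr2n opprD addrA ![_ - b - _]addrAC.
- by rewrite opprD addrA.
- by rewrite subrK.
Qed.

(** As x4 commutes with x2, x3, x5 and x6, rescaling multiplies brackets by x4: [x6,x2] = x4 becomes
    9 x4^2 = 1, and [x5,x3] = -3 x4 becomes -9 x4^2 = -1. *)
Lemma A1_to_R_relators (K : fieldType) (B : pzAlgType K) (x1 x2 x3 x4 x5 x6 : B) :
    (3%:R : K) != 0 -> all (pred1 0) (A1_relators x1 x2 x3 x4 x5 x6) ->
  all (pred1 0) (R_relators x2 x3 x4 ((x4 * x5) *+ 3) ((x4 * x6) *+ 9)) /\
  [/\ (x4 * x3 ^+ 2 - x2 * ((x4 * x5) *+ 3)) *+ 3 = x1,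
      x4 * (x4 * x5 *+ 3) *+ 3 = x5 & x4 * (x4 * x6 *+ 9) = x6].
Proof.
move=> nz3; rewrite /= !subr_eq0 !andbT.
case/and5P=> _ _ /eqP c32 /eqP c41 /and5P[/eqP c42 /eqP c43 _ /eqP c52].
case/and5P=> /eqP c53 /eqP c54 _ /eqP c62 /and5P[/eqP c63 /eqP c64 /eqP c65].
move=> /eqP x33 /eqP x44.
have x4K u : (x4 * (x4 * u)) *+ 9 = u by exact: alg_map9V.
have x4K1 : (x4 * x4) *+ 9 = 1 by have := x4K 1; rewrite mulr1.
split; last first.
  split; try by rewrite !mulrnAr -?mulrnA x4K.
  have -> : x2 * ((x4 * x5) *+ 3) = x4 * ((x2 * x5) *+ 3).
    by rewrite !mulrnAr !mulrA c42.
  (* Replacing x3^2 by the quadratic relation leaves 3 x4 x1 x4, whose triple is 9 x4^2 x1 = x1. *)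
  by rewrite -x33 mulrDr addrK mulrnAr -c41 -mulrnA x4K.
rewrite x44 !(mulrnAl, mulrnAr) eqxx.
do 10?[apply/andP; split=> //]; apply/eqP=> //.
- by rewrite -mulrA c52 !mulrA c42.
- by rewrite -mulrA c54.
- by rewrite -mulrA c63 !mulrA c43.
- by rewrite -mulrA c64.
- have -> : x4 * x6 * (x4 * x5) = x4 * x5 * (x4 * x6).
    by rewrite -mulrA (mulrA x6) c64 -(mulrA x4 x5) (mulrA x5) c54 -!mulrA c65.
  exact: mulrnAC.
- by rewrite -mulrA c62 mulrDr mulrnDl x4K1 !mulrA c42.
- by rewrite -mulrA c53 mulrBr mulrnBl mulrnAr -[_ *+ 3 *+ 3]mulrnA x4K1 !mulrA c43.
Qed.

(** * Generators and universal properties of [A1] and [Ralg] *)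

(** [A1] is a quotient of a quotient; the composite projection lets its elements be handled as
    images from the free algebra. *)
Definition A1_pi (K : fieldType) : {rmorphism free_alg (base K) 6 -> A1 K} :=
  alg_quot_pi [:: alg_map (base_z K - 1) : Az K] \o alg_quot_pi (Az_relations K).

Lemma A1_pi_ext (K : fieldType) (T : Type) (g h : A1 K -> T) :
  (forall u, g (A1_pi K u) = h (A1_pi K u)) -> g =1 h.
Proof. by move=> gh; apply: alg_quot_ext => x; move: x; apply: alg_quot_ext. Qed.

Lemma A1_pi_rel (K : fieldType) (r : free_alg (base K) 6) :
  r \in Az_relations K -> A1_pi K r = 0.
Proof. by move=> /alg_quot_pi0; rewrite /A1_pi /= => ->; rewrite rmorph0. Qed.

Lemma A1_pi_const (K : fieldType) (c : K) :
  A1_pi K (alg_map (base_const K c)) = alg_map c.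
Proof. by []. Qed.

Lemma A1_pi_z (K : fieldType) : A1_pi K (alg_map (base_z K)) = 1.
Proof.
apply/eqP; rewrite -subr_eq0 -(rmorph1 (A1_pi K)) -rmorphB; apply/eqP.
rewrite -(rmorph1 (@alg_map (base K) (free_alg (base K) 6))) -rmorphB.
by apply: alg_quot_pi0; rewrite mem_head.
Qed.

Definition A1_gen (K : fieldType) (i : 'I_6) : A1 K := A1_pi K (free_gen (base K) i).

Definition Ralg_gen (K : fieldType) (i : 'I_5) : Ralg K :=
  alg_quot_pi (Ralg_relations K) (free_gen K i).

Lemma all_map_eq0 (A B : pzRingType) (h : {rmorphism A -> B}) (G : seq A) :
  reflect (forall r, r \in G -> h r = 0) (all (pred1 0) (map h G)).
Proof. by rewrite all_map; apply: (iffP allP) => hG r /hG /eqP. Qed.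

(** One direction gives the relations among the generators of [A1], the other builds morphisms out
    of [A1]. Here 9 is a unit of the base ring because it is a nonzero constant. *)
Lemma Az_relatorsP (K : fieldType) (B : pzAlgType K)
    (ev : {rmorphism base K -> K}) (h : {rmorphism free_alg (base K) 6 -> B})
    (x := fun i => h (free_gen (base K) i)) :
    (3%:R : K) != 0 -> ev (base_z K) = 1 ->
    (forall b, h (alg_map b) = alg_map (ev b)) ->
  (forall r, r \in Az_relations K -> h r = 0) <->
  all (pred1 0) (A1_relators (x (e 1)) (x (e 2)) (x (e 3)) (x (e 4)) (x (e 5)) (x (e 6))).
Proof.
move=> nz3 evz hC.
have nz9 : (9%:R : K) != 0 by rewrite (natrM _ 3 3) mulf_neq0.
have U9 : (9%:R : base K) \is a GRing.unit.
  by rewrite -(rmorph_nat (base_const K)) rmorph_unit ?unitfE.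
rewrite -(@map_Az_relators _ _ (base_z K) _ _ ev) ?base_z_unit //; last first.
  by move=> b; rewrite -alg_map_malg mulr1.
by rewrite -Az_relationsE; split=> /all_map_eq0.
Qed.

Lemma Ralg_relatorsP (K : fieldType) (B : pzAlgType K)
    (h : {rmorphism free_alg K 5 -> B}) (y := fun i => h (free_gen K i)) :
    (forall c, h (alg_map c) = alg_map c) ->
  (forall r, r \in Ralg_relations K -> h r = 0) <->
  all (pred1 0) (R_relators (y (f 2)) (y (f 3)) (y (f 4)) (y (f 5)) (y (f 6))).
Proof.
move=> hC; rewrite -map_R_relators // -Ralg_relationsE.
by split=> /all_map_eq0.
Qed.

(** The base ring acts on [A1] through evaluation at 1: both sides are ring morphisms in [b] that
    agree on constants and on z. *)
Lemma A1_pi_map (K : fieldType) (ev : {rmorphism base K -> K}) (b : base K) :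
    (forall c, ev (base_const K c) = c) -> ev (base_z K) = 1 ->
  A1_pi K (alg_map b) = alg_map (ev b).
Proof.
move=> evC evz; move: b.
apply: (@base_rmorph_ext _ _ (A1_pi K \o alg_map) (alg_map \o ev)) => [c|].
  by rewrite [RHS](congr1 alg_map (evC c)).
by rewrite [LHS]A1_pi_z [RHS](congr1 alg_map evz) rmorph1.
Qed.

Lemma A1_gen_relators (K : fieldType) (x := A1_gen K) : (3%:R : K) != 0 ->
  all (pred1 0) (A1_relators (x (e 1)) (x (e 2)) (x (e 3)) (x (e 4)) (x (e 5)) (x (e 6))).
Proof.
move=> nz3; have [ev evC evz] := base_eval1 nz3.
exact: (Az_relatorsP nz3 evz (fun b => A1_pi_map b evC evz)).1 (@A1_pi_rel K).
Qed.

Lemma Ralg_gen_relators (K : fieldType) (y := Ralg_gen K) :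
  all (pred1 0) (R_relators (y (f 2)) (y (f 3)) (y (f 4)) (y (f 5)) (y (f 6))).
Proof.
pose q := alg_quot_pi (Ralg_relations K).
exact: (Ralg_relatorsP (fun c => erefl (q (alg_map c)))).1 (@alg_quot_pi0 _ _).
Qed.

(** The target becomes an algebra over the base ring through evaluation at 1. The map from the free
    algebra then factors through both quotients, the second because z - 1 evaluates to 0. *)
Lemma A1_rmorph (K : fieldType) (B : pzAlgType K) (x1 x2 x3 x4 x5 x6 : B) :
    (3%:R : K) != 0 -> all (pred1 0) (A1_relators x1 x2 x3 x4 x5 x6) ->
  exists2 g : {rmorphism A1 K -> B}, forall c, g (alg_map c) = alg_map c &
    forall i, g (A1_gen K i) = [:: x1; x2; x3; x4; x5; x6]`_i.
Proof.
move=> nz3 relx; have [ev evC evz] := base_eval1 nz3.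
have evc b u : alg_map (ev b) * u = u * alg_map (ev b) :> B.
  exact: alg_map_central.
have [h hC hg] := @free_alg_rmorph _ 6 _ (@alg_map K B \o ev)
  (fun i => [:: x1; x2; x3; x4; x5; x6]`_i) evc.
have [|h' h'E] := @alg_quot_rmorph _ _ (Az_relations K) h.
  by apply: (Az_relatorsP nz3 evz hC).2; rewrite !hg.
have [|g gE] := @alg_quot_rmorph _ _ [:: alg_map (base_z K - 1) : Az K] h'.
  move=> r; rewrite inE => /eqP ->.
  rewrite -[alg_map _]/(alg_quot_pi (Az_relations K) (alg_map (base_z K - 1))).
  by rewrite h'E hC /= rmorphB rmorph1 evz subrr rmorph0.
have gpi u : g (A1_pi K u) = h u by rewrite -h'E -gE.
exists g => [c|i]; last by rewrite -hg -gpi.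
by rewrite -A1_pi_const gpi hC [LHS](congr1 alg_map (evC c)).
Qed.

Lemma Ralg_rmorph (K : fieldType) (B : pzAlgType K) (y2 y3 y4 y5 y6 : B) :
    all (pred1 0) (R_relators y2 y3 y4 y5 y6) ->
  exists2 g : {rmorphism Ralg K -> B}, forall c, g (alg_map c) = alg_map c &
    forall i, g (Ralg_gen K i) = [:: y2; y3; y4; y5; y6]`_i.
Proof.
move=> rely; have [h hC hg] := free_alg_rmorph
  (fun i : 'I_5 => [:: y2; y3; y4; y5; y6]`_i) (@alg_map_central K B).
have [|g gE] := @alg_quot_rmorph _ _ (Ralg_relations K) h.
  by apply: (Ralg_relatorsP hC).2; rewrite !hg.
exists g => [c|i]; first exact: etrans (gE _) (hC c).
exact: etrans (gE _) (hg i).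
Qed.

(** Agreement on scalars from K suffices, since in [A1] every scalar of the base ring equals one
    from K. *)
Lemma A1_ext (K : fieldType) (B : pzAlgType K) (g h : {rmorphism A1 K -> B}) :
    (3%:R : K) != 0 -> (forall c, g (alg_map c) = h (alg_map c)) ->
    (forall i, g (A1_gen K i) = h (A1_gen K i)) -> g =1 h.
Proof.
move=> nz3 ghC ghg; have [ev evC evz] := base_eval1 nz3.
apply: A1_pi_ext.
apply: (@free_alg_ext _ _ _ (g \o A1_pi K) (h \o A1_pi K)) => [b|i].
  by rewrite -[LHS]/(g _) -[RHS]/(h _) (A1_pi_map b evC evz).
exact: ghg.
Qed.

Lemma Ralg_ext (K : fieldType) (B : pzAlgType K) (g h : {rmorphism Ralg K -> B}) :
    (forall c, g (alg_map c) = h (alg_map c)) ->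
    (forall i, g (Ralg_gen K i) = h (Ralg_gen K i)) -> g =1 h.
Proof.
move=> ghC ghg; pose q := alg_quot_pi (Ralg_relations K).
by apply: alg_quot_ext; apply: (@free_alg_ext _ _ _ (g \o q) (h \o q)).
Qed.

(** * The two mutually inverse morphisms *)

Theorem proposition4p9 (K : fieldType) (charK : 3%N \notin [pchar K]%R) :
  pzalg_isomorphic (Ralg K) (A1 K).
Proof.
have nz3 : (3%:R : K) != 0 by move: charK; rewrite inE.
have [relR [x1E x5E x6E]] := A1_to_R_relators nz3 (A1_gen_relators nz3).
have [relA [y5E y6E]] := R_to_A1_relators nz3 (Ralg_gen_relators K).
have [phi phiC phig] := Ralg_rmorph relR.
have [psi psiC psig] := A1_rmorph nz3 relA.
exists phi; last exact: phiC.
exists psi.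
  apply: (@Ralg_ext _ _ (psi \o phi) idfun) => [c|i].
    by rewrite -[LHS]/(psi (phi _)) phiC psiC.
  rewrite -[LHS]/(psi (phi _)) -[RHS]/(Ralg_gen K i) phig.
  (* Indices 0 to 4 stand for f2 to f6. The first three generators go back and forth unchanged;
     [y5E] and [y6E] settle the last two. *)
  case: i => -[|[|[|[|[|//]]]]] lt; rewrite (bool_irrelevance lt isT) -[LHS]/(psi _).
  - exact: psig.
  - exact: psig.
  - exact: psig.
  - by rewrite rmorphMn rmorphM !psig.
  - by rewrite rmorphMn rmorphM !psig.
apply: (@A1_ext _ _ (phi \o psi) idfun nz3) => [c|i].
  by rewrite -[LHS]/(phi (psi _)) psiC phiC.
rewrite -[LHS]/(phi (psi _)) -[RHS]/(A1_gen K i) psig.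
(* Indices 0 to 5 stand for e1 to e6; [x1E], [x5E] and [x6E] settle e1, e5 and e6. *)
case: i => -[|[|[|[|[|[|//]]]]]] lt; rewrite (bool_irrelevance lt isT) -[LHS]/(phi _).
- by rewrite rmorphMn rmorphB !rmorphM !phig.
- exact: phig.
- exact: phig.
- exact: phig.
- by rewrite rmorphMn rmorphM !phig.
- by rewrite rmorphM !phig.
Qed.
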